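(* If $G$ and $H$ are graphs, then $$M(G\,\square\,H;x,y)=D_G(xy)\,M(H;x,y)+D_H(xy)\,M(G;x,y).$$
   Context: All graphs are finite, simple, and undirected. For a graph $G$, $\deg_G(g)$ denotes the degree of $g\in V(G)$. For $i\ge 0$ let $n_i(G)=|\{g\in V(G): \deg_G(g)=i\}|$, and for $i\le j$ let $m_{i,j}(G)=|\{\{g,g'\}\in E(G): \{\deg_G(g),\deg_G(g')\}=\{i,j\}\}|$. The degree polynomial of $G$ is $D_G(t)=\sum_{i} n_i(G)\,t^i$ (sum over all vertex degrees $i$ of $G$), and the M-polynomial of $G$ is $M(G;x,y)=\sum_{i\le j} m_{i,j}(G)\,x^iy^j$. The Cartesian product $G\,\square\,H$ has vertex set $V(G)\times V(H)$; vertices $(g_1,h_1)$ and $(g_2,h_2)$ are adjacent if $g_1=g_2$ and $h_1h_2\in E(H)$, or $h_1=h_2$ and $g_1g_2\in E(G)$. *)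

(* Defs.v *)
From mathcomp Require Import all_boot all_order all_algebra.
From mathcomp Require Import mpoly.

Set Implicit Arguments.
Unset Strict Implicit.
Unset Printing Implicit Defensive.

Import GRing.Theory.
Local Open Scope ring_scope.

Record sgraph := SGraph {
  vertex :> finType;
  adj : rel vertex;
  adj_sym : ssrbool.symmetric adj;
  adj_irrefl : irreflexive adj
}.

Definition edges (G : sgraph) : {set {set G}} :=
  [set [set g; g'] | g in G, g' in G & adj g g'].

Definition deg (G : sgraph) (g : G) : nat := #|[set g' : G | adj g g']|.

Definition ndeg (G : sgraph) (i : nat) : nat := #|[set g : G | deg g == i]|.

(* The condition {deg g, deg g'} = {i, j} on an edge A = {g, g'} is an equality
   of multisets of degrees. *)
Definition medge (G : sgraph) (i j : nat) : nat :=
  #|[set A in edges G | perm_eq [seq deg g | g in A] [:: i; j]]|.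

(* In a simple graph every degree is smaller than the number of vertices, so
   the sums in the next two definitions range over all possible degrees. *)
Definition degree_poly (G : sgraph) : {poly int} :=
  \sum_(i < #|G|) (ndeg G i)%:R *: 'X^i.

Definition varx : {mpoly int[2]} := 'X_ord0.
Definition vary : {mpoly int[2]} := 'X_ord_max.

Definition M_poly (G : sgraph) : {mpoly int[2]} :=
  \sum_(i < #|G|) \sum_(j < #|G| | (i <= j)%N)
    (medge G i j)%:R *: (varx ^+ i * vary ^+ j).

Section CartesianProduct.
Variables G H : sgraph.

Definition cart_adj : rel (G * H) := fun u v =>
  (u.1 == v.1) && adj u.2 v.2 || (u.2 == v.2) && adj u.1 v.1.

Lemma cart_adj_sym : ssrbool.symmetric cart_adj.
Proof.
by move=> u v; rewrite /cart_adj [adj u.2 _]adj_sym [adj u.1 _]adj_sym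
  ![u.1 == _]eq_sym ![u.2 == _]eq_sym.
Qed.

Lemma cart_adj_irrefl : irreflexive cart_adj.
Proof. by move=> u; rewrite /cart_adj !adj_irrefl !andbF. Qed.

Definition cart_prod : sgraph := SGraph cart_adj_sym cart_adj_irrefl.

End CartesianProduct.

(* Main.v *)
(* Count every edge through its two orientations. Then 2 M(G; x, y) is the sum
   of x^min(d, d') y^max(d, d') over the arcs of G, where d and d' are the
   degrees of the end points. In G □ H degrees add, and an arc is a vertex of one
   factor together with an arc of the other; the degree of that vertex is added
   to both d and d', which contributes the factor (xy)^deg. Finally 2 is
   cancelled in Z[x, y]. *)
Require Import Defs.
From mathcomp Require Import all_boot all_order all_algebra.
From mathcomp Require Import mpoly.

Set Implicit Arguments.
Unset Strict Implicit.
Unset Printing Implicit Defensive.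

Import GRing.Theory.
Local Open Scope ring_scope.

Lemma eq_set2_pair (T : finType) (a b c d : T) : a != b ->
  ([set a; b] == [set c; d]) = ((a, b) \in [set (c, d); (d, c)]).
Proof.
move=> neq_ab; rewrite !inE !xpair_eqE.
apply/eqP/orP => [eq_ab | [] /andP[/eqP-> /eqP->] //]; last by rewrite setUC.
have: a \in [set c; d] by rewrite -eq_ab set21.
have: b \in [set c; d] by rewrite -eq_ab set22.
rewrite !inE => /orP[] /eqP eb /orP[] /eqP ea; move: neq_ab;
  rewrite ea eb !eqxx //; by [right | left].
Qed.

Lemma adj_neq (G : sgraph) (g g' : G) : adj g g' -> g != g'.
Proof. by apply: contraTneq => ->; rewrite adj_irrefl. Qed.

Lemma mem_edges (G : sgraph) (g g' : G) : adj g g' -> [set g; g'] \in edges G.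
Proof. by move=> adj_gg'; apply: imset2_f; rewrite // inE. Qed.

(** The fibre of [p |-> [set p.1; p.2]] over an edge {g, g'} consists of the arcs [(g, g')] and
    [(g', g)], which are distinct because there are no loops. *)
Lemma card_arcs (G : sgraph) (P : pred {set G}) :
  #|[set p : G * G | adj p.1 p.2 && P [set p.1; p.2]]| =
    (#|[set A in edges G | P A]| * 2)%N.
Proof.
rewrite -sum1_card (partition_big (fun p : G * G => [set p.1; p.2])
  (mem [set A in edges G | P A])) /=; last first.
  by move=> p; rewrite !inE => /andP[/mem_edges-> ->].
rewrite -sum_nat_const; apply: eq_bigr => A; rewrite inE.
case/andP=> /imset2P[g g' _]; rewrite inE => /andP[_ adj_gg'] -> PA.
rewrite sum1_card -[RHS](_ : #|[set (g, g'); (g', g)]| = 2%N); last first.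
  by rewrite cards2 xpair_eqE (negPf (adj_neq adj_gg')).
apply: eq_card => -[a b]; rewrite [LHS]/in_mem /= inE /=.
have [adj_ab | adjN_ab] := boolP (adj a b) => /=.
  rewrite eq_set2_pair ?adj_neq // -eq_set2_pair ?adj_neq //.
  by case: eqP => [->|]; rewrite ?PA ?andbF.
rewrite !inE !xpair_eqE; apply/esym/negbTE; apply: contra adjN_ab.
by case/orP=> /andP[/eqP-> /eqP->]; rewrite // adj_sym.
Qed.

(** The set is enumerated in an unspecified order, hence a statement up to permutation; [a != b]
    gives two entries even when [f a = f b]. *)
Lemma perm_image_set2 (T : finType) (f : T -> nat) (a b : T) (s : seq nat) :
  a != b -> perm_eq [seq f x | x in [set a; b]] s = perm_eq [:: f a; f b] s.
Proof.
move=> neq_ab; apply: (permPl _ s); apply: (perm_map f (t := [:: a; b])).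
apply: uniq_perm; rewrite ?enum_uniq //= ?inE ?neq_ab // => x.
by rewrite mem_enum !inE.
Qed.

(** Lists are permutations of each other exactly when their sorted versions agree, and [[:: i; j]]
    is already sorted. *)
Lemma perm_eq2_minmax (a b i j : nat) : (i <= j)%N ->
  perm_eq [:: a; b] [:: i; j] = (minn a b == i) && (maxn a b == j).
Proof.
move=> le_ij.
rewrite (sameP (perm_sortP leq_total leq_trans anti_leq _ _) eqP).
rewrite /sort /= le_ij.
by case: leqP => [|] _; rewrite !eqseq_cons andbT.
Qed.

Lemma medge_double (G : sgraph) (i j : nat) : (i <= j)%N ->
  (medge G i j * 2)%N = #|[set p : G * G | adj p.1 p.2 &&
    ((minn (deg p.1) (deg p.2) == i) && (maxn (deg p.1) (deg p.2) == j))]|.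
Proof.
move=> le_ij; rewrite /medge
  -(card_arcs (fun A : {set G} => perm_eq [seq deg g | g in A] [:: i; j])).
apply: eq_card => -[a b]; rewrite !inE /=.
have [adj_ab|//] := boolP (adj a b).
by rewrite perm_image_set2 ?adj_neq // perm_eq2_minmax.
Qed.

Lemma deg_lt (G : sgraph) (g : G) : (deg g < #|G|)%N.
Proof.
rewrite -cardsT; apply: proper_card; apply/properP; split; first exact: subsetT.
by exists g; rewrite !inE // adj_irrefl.
Qed.

(** Symmetric in [i] and [j], so both orientations of an edge carry the same monomial. *)
Definition arc_weight (i j : nat) : {mpoly int[2]} :=
  varx ^+ minn i j * vary ^+ maxn i j.

Lemma arc_weightD (d i j : nat) :
  arc_weight (d + i) (d + j) = (varx * vary) ^+ d * arc_weight i j.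
Proof. by rewrite /arc_weight -addn_minr -addn_maxr !exprD exprMn mulrACA. Qed.

Lemma M_poly_double (G : sgraph) :
  M_poly G *+ 2 = \sum_(g : G) \sum_(g' | adj g g') arc_weight (deg g) (deg g').
Proof.
(* By [deg_lt], the smaller and larger end degrees of an arc are valid indices of the two sums in
   [M_poly]; arcs are grouped by this pair of values. *)
pose lo (p : G * G) : 'I_#|G| :=
  Ordinal (leq_ltn_trans (geq_minl (deg p.1) (deg p.2)) (deg_lt p.1)).
have hi_lt (p : G * G) : (maxn (deg p.1) (deg p.2) < #|G|)%N.
  by rewrite gtn_max !deg_lt.
pose hi p := Ordinal (hi_lt p).
rewrite pair_big_dep /= (partition_big lo xpredT) //= /M_poly -sumrMnl.
apply: eq_bigr => i _.
rewrite (partition_big hi (fun j : 'I_#|G| => (i <= j)%N)) /=; last first.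
  by move=> p /andP[_ /eqP<-] /=; rewrite leq_max geq_minl.
rewrite -sumrMnl; apply: eq_bigr => j le_ij.
rewrite (eq_bigr (fun=> varx ^+ i * vary ^+ j)); last first.
  by move=> p /andP[/andP[_ /eqP<-] /eqP<-].
rewrite sumr_const scaler_nat -mulrnA medge_double //; congr (_ *+ _).
by apply: eq_card => p; rewrite [RHS]/in_mem /= inE -!val_eqE /= andbA.
Qed.

Lemma horner_degree_poly (G : sgraph) (a : {mpoly int[2]}) :
  horner_alg a (degree_poly G) = \sum_(g : G) a ^+ deg g.
Proof.
rewrite /degree_poly rmorph_sum /=.
rewrite [RHS](partition_big (fun g => Ordinal (deg_lt g)) xpredT) //=.
apply: eq_bigr => i _.
rewrite (eq_bigr (fun=> a ^+ i)) => [|g /eqP<-//].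
rewrite sumr_const scaler_nat rmorphMn rmorphXn /= horner_algX; congr (_ *+ _).
by apply: eq_card => g; rewrite inE.
Qed.

(** The neighbours of [(g, h)] are split by whether the first coordinate stays [g]. Irreflexivity of
    [adj] keeps the two kinds of neighbour apart. *)
Lemma sum_cart_adj (V : nmodType) (G H : sgraph) (g : G) (h : H)
    (F : G -> H -> V) :
  \sum_(v : cart_prod G H | adj ((g, h) : cart_prod G H) v) F v.1 v.2 =
    \sum_(h' | adj h h') F g h' + \sum_(g' | adj g g') F g' h.
Proof.
rewrite (bigID (fun v : G * H => v.1 == g)) /=; congr (_ + _).
- rewrite (eq_bigl (fun v : G * H => (v.1 == g) && adj h v.2)); last first.
    case=> a b; rewrite /= /cart_adj /= [g == a]eq_sym.
    by case: eqP => [->|]; rewrite ?andbF // adj_irrefl andbF orbF andbT.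
  by rewrite -(pair_big (pred1 g) (adj h) F) big_pred1_eq.
- rewrite (eq_bigl (fun v : G * H => adj g v.1 && (v.2 == h))); last first.
    case=> a b; rewrite /= /cart_adj /= [g == a]eq_sym [h == b]eq_sym.
    by case: eqP => [->|] /=; rewrite ?adj_irrefl ?andbF // andbT andbC.
  by rewrite -(pair_big (adj g) (pred1 h) F); under eq_bigr do rewrite big_pred1_eq.
Qed.

Lemma deg_cart (G H : sgraph) (u : cart_prod G H) :
  deg u = (deg u.1 + deg u.2)%N.
Proof.
case: u => g h; rewrite /deg -!sum1dep_card /=.
by rewrite (sum_cart_adj g h (fun _ _ => 1%N)) addrC.
Qed.

(* [horner_alg a p] is the value at [a] of a polynomial [p] over the base ring. *)
Theorem theorem3p1 (G H : sgraph) :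
  M_poly (cart_prod G H) =
    horner_alg (varx * vary) (degree_poly G) * M_poly H
    + horner_alg (varx * vary) (degree_poly H) * M_poly G.
Proof.
(* Compared coefficient by coefficient, this is cancellation of 2 in the integers. *)
have mul2I : injective (fun p : {mpoly int[2]} => p *+ 2).
  move=> p q /= /mpolyP eq_pq; apply/mpolyP => m.
  by apply/eqP; rewrite -(Num.Theory.eqr_pMn2r (n := 2)) // -!mcoeffMn eq_pq.
apply: mul2I => /=; rewrite mulrnDl -!mulrnAr !M_poly_double !horner_degree_poly.
(* The arcs leaving [(g, h)] are sorted by the factor in which they move; the degree of the fixed
   coordinate is pulled out by [arc_weightD]. *)
transitivity (\sum_(g : G) \sum_(h : H)
  (\sum_(h' | adj h h') (varx * vary) ^+ deg g * arc_weight (deg h) (deg h')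
   + \sum_(g' | adj g g') (varx * vary) ^+ deg h * arc_weight (deg g) (deg g'))).
  rewrite pair_big /=; apply: eq_bigr => -[g h] _ /=.
  under eq_bigr do rewrite !deg_cart /=.
  rewrite (sum_cart_adj g h (fun g' h' =>
    arc_weight (deg g + deg h) (deg g' + deg h'))).
  congr (_ + _); apply: eq_bigr => z _; first exact: arc_weightD.
  by rewrite [(_ + deg h)%N]addnC [(deg z + _)%N]addnC arc_weightD.
under eq_bigr do rewrite big_split /=.
(* In the second sum the fixed vertex is [h], so its summation is moved outermost before
   factoring. *)
rewrite big_split /=; congr (_ + _); last rewrite exchange_big.
all: rewrite mulr_suml; apply: eq_bigr => u _.
all: by rewrite mulr_sumr; apply: eq_bigr => v _; rewrite mulr_sumr.
Qed.
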